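(* Let $F$ be a finite abelian group, $r \in \mathbb{N}$, and $G = F \times \mathbb{T}^r$, where $\mathbb{T}$ is the multiplicative group of complex numbers of modulus one. Let $K \subset \widehat{G}$. Then $K$ is strictly positive definite if and only if $K$ is ubiquitous.
   Context: For a compact abelian group $G$ with character group $\widehat{G}$ (here $\widehat{G} \cong \widehat{F} \times \mathbb{Z}^r$, where $m \in \mathbb{Z}^r$ acts on $\mathbb{T}^r$ by $z \mapsto z_1^{m_1}\cdots z_r^{m_r}$): a trigonometric polynomial on $\widehat{G}$ is a function of the form $\gamma \mapsto \sum_{i=1}^n c_i \gamma(x_i)$ with $n \in \mathbb{N}$, $x_1,\dots,x_n \in G$, $c_1,\dots,c_n \in \mathbb{C}$. A subset $K \subset \widehat{G}$ is called strictly positive definite if the only trigonometric polynomial on $\widehat{G}$ vanishing at every point of $K$ is the identically zero function. A subset $K \subset \widehat{G}$ is called ubiquitous if for every subgroup $H$ of $\widehat{G}$ of finite index and every $\gamma \in \widehat{G}$ the coset $\gamma H$ meets $K$. *)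

(* Defs.v *)
From mathcomp Require Import all_boot all_fingroup.
From Stdlib Require Import Reals ZArith.

Set Implicit Arguments.
Unset Strict Implicit.
Unset Printing Implicit Defensive.

Definition C : Type := (R * R)%type.
Definition C0 : C := (0%R, 0%R).
Definition C1 : C := (1%R, 0%R).
Definition Cadd (z w : C) : C := (z.1 + w.1, z.2 + w.2)%R.
Definition Cmul (z w : C) : C := (z.1 * w.1 - z.2 * w.2, z.1 * w.2 + z.2 * w.1)%R.
Definition Cnorm2 (z : C) : R := (z.1 * z.1 + z.2 * z.2)%R.
Definition Cinv (z : C) : C := (z.1 / Cnorm2 z, - z.2 / Cnorm2 z)%R.
Definition unitC (z : C) : Prop := Cnorm2 z = 1%R.
Fixpoint Cpow (z : C) (n : nat) : C :=
  match n with O => C1 | S n' => Cmul z (Cpow z n') end.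
Definition Czpow (z : C) (n : Z) : C :=
  match n with
  | Z0 => C1
  | Zpos p => Cpow z (Pos.to_nat p)
  | Zneg p => Cpow (Cinv z) (Pos.to_nat p)
  end.

Definition Gpt (F : finGroupType) (r : nat) : Type := (F * ('I_r -> C))%type.
Definition inG (F : finGroupType) (r : nat) (p : Gpt F r) : Prop :=
  forall k, unitC (p.2 k).

Definition GhatRaw (F : finGroupType) (r : nat) : Type :=
  ((F -> C) * ('I_r -> Z))%type.
(* chi is a character of F (a homomorphism F -> T; values automatically of
   modulus one since F is finite) *)
Definition is_char (F : finGroupType) (chi : F -> C) : Prop :=
  chi 1%g = C1 /\ forall x y : F, chi (x * y)%g = Cmul (chi x) (chi y).
Definition isGhat (F : finGroupType) (r : nat) (g : GhatRaw F r) : Prop :=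
  is_char g.1.

Definition ghat_one (F : finGroupType) (r : nat) : GhatRaw F r :=
  (fun _ => C1, fun _ => 0%Z).
Definition ghat_mul (F : finGroupType) (r : nat) (g h : GhatRaw F r) : GhatRaw F r :=
  (fun x => Cmul (g.1 x) (h.1 x), fun k => (g.2 k + h.2 k)%Z).
Definition ghat_inv (F : finGroupType) (r : nat) (g : GhatRaw F r) : GhatRaw F r :=
  (fun x => Cinv (g.1 x), fun k => (- g.2 k)%Z).

Definition ghat_eval (F : finGroupType) (r : nat) (g : GhatRaw F r) (p : Gpt F r) : C :=
  Cmul (g.1 p.1) (\big[Cmul/C1]_(k < r) Czpow (p.2 k) (g.2 k)).

Definition trigpoly (F : finGroupType) (r n : nat) (c : 'I_n -> C)
    (x : 'I_n -> Gpt F r) (g : GhatRaw F r) : C :=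
  \big[Cadd/C0]_(i < n) Cmul (c i) (ghat_eval g (x i)).

Definition strictly_pd (F : finGroupType) (r : nat) (K : GhatRaw F r -> Prop) : Prop :=
  forall (n : nat) (x : 'I_n -> Gpt F r) (c : 'I_n -> C),
    (forall i, inG (x i)) ->
    (forall g, K g -> trigpoly c x g = C0) ->
    forall g, isGhat g -> trigpoly c x g = C0.

Definition ghat_subgroup (F : finGroupType) (r : nat) (H : GhatRaw F r -> Prop) : Prop :=
  (forall g, H g -> isGhat g) /\ H (ghat_one F r) /\
  (forall g h, H g -> H h -> H (ghat_mul g (ghat_inv h))).

Definition finite_index (F : finGroupType) (r : nat) (H : GhatRaw F r -> Prop) : Prop :=
  exists (k : nat) (l : 'I_k -> GhatRaw F r),
    (forall i, isGhat (l i)) /\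
    forall g, isGhat g -> exists i, H (ghat_mul (ghat_inv (l i)) g).

Definition ubiquitous (F : finGroupType) (r : nat) (K : GhatRaw F r -> Prop) : Prop :=
  forall H, ghat_subgroup H -> finite_index H ->
  forall g, isGhat g -> exists h, H h /\ K (ghat_mul g h).

(* Main.v *)
From Stdlib Require Import Reals ZArith.
Require Import Defs.
From mathcomp Require Import all_boot all_order all_fingroup all_algebra.
From mathcomp Require Import all_solvable all_field.
From mathcomp Require Import boolp Rstruct complex zify ssrZ.

(** Suppose [K] is ubiquitous and a trigonometric polynomial [f] has
    [f g0 <> 0].  The coefficients, the coordinates of the points and their
    inverses generate a ring that is finitely generated over [int], so it has a
    ring morphism to a finite field [k] which does not kill [f g0].  With
    [N := #|k| - 1], every [N]-th power of a coordinate maps to 1; hence [f]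
    agrees modulo the kernel with [f g0] on the coset of [g0] modulo
    [{1} x N Z^r], a subgroup of finite index, and has no zero there.

    Conversely, a subgroup of finite index [n] contains [{1} x N Z^r] for
    [N := n!], and the indicator function of each coset of the latter is a
    trigonometric polynomial, by orthogonality of characters and summation over
    [N]-th roots of unity. *)

Set Implicit Arguments.
Unset Strict Implicit.
Unset Printing Implicit Defensive.
Import GRing.Theory Num.Theory.
Local Open Scope ring_scope.
(* MathComp rebinds the key [%Z] to [int_scope]. *)
Delimit Scope Z_scope with coqZ.

(** * Specialization to finite fields *)

(** In a finite splitting field, [p] is up to a unit the product of the ['X - w] over its list of
    roots, which cannot be empty since [p] is not constant. *)
Lemma finField_ext_root (k : finFieldType) (p : {poly k}) : (1 < size p)%N ->
  exists (k' : finFieldType) (j : {rmorphism k -> k'}) (w : k'),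
    root (map_poly j p) w.
Proof.
move=> p_gt1; have p_neq0 : p != 0 by rewrite -size_poly_gt0 ltnW.
have [L [rs Dp _]] := FinSplittingFieldFor p_neq0.
exists (FinFieldExtType L), (in_alg L).
case: rs Dp => [|w rs] Dp; last first.
  by exists w; rewrite (eqp_root Dp) big_cons rootM root_XsubC eqxx.
move: (eqp_size Dp); rewrite big_nil size_poly1 size_map_poly => p1.
by rewrite p1 in p_gt1.
Qed.

Lemma expf_card_pred (F : finFieldType) (x : F) : x != 0 -> x ^+ #|F|.-1 = 1.
Proof.
move=> xN0; apply: (mulfI xN0); rewrite mulr1 -exprS prednK ?expf_card //.
by apply/card_gt0P; exists 0.
Qed.

(* [phi] factors through the image of [iota]; not requiring [iota] to be
   injective lets the induction on the number of generators run over polynomial rings. *)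
Definition specializable (L : fieldType) (R : comNzRingType) : Prop :=
  forall (iota : {rmorphism R -> L}) (a : R), iota a != 0 ->
  exists (k : finFieldType) (phi : {rmorphism R -> k}),
    phi a != 0 /\ forall x, iota x = 0 -> phi x = 0.

(** Reduction modulo a prime larger than the absolute value of [a] does not kill [a]. The kernel
    condition is trivial, as [iota] is injective in characteristic zero. *)
Lemma specializable_int (L : numFieldType) : specializable L int.
Proof.
move=> iota a a_neq0.
have {}a_neq0 : a != 0 by apply: contraNneq a_neq0 => ->; rewrite rmorph0.
have [p lt_ap p_pr] := prime_above `|a|%N.
exists 'F_p, intr; split; last first.
  move=> x; rewrite -[x in iota x]intz rmorph_int => /eqP.
  by rewrite intr_eq0 => /eqP ->.
have [e ->] : exists e : bool, a = (-1) ^+ e * `|a|%N%:Z.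
  by exists (a < 0); rewrite {1}[a]intEsign.
rewrite rmorphM rmorph_sign mulf_neq0 ?signr_eq0 //.
by rewrite /= -(dvdn_pcharf (pchar_Fp p_pr)) gtnNdvd // absz_gt0.
Qed.

Lemma poly_drop_lead (R : nzRingType) (p : {poly R}) : p != 0 ->
  exists2 q : {poly R}, (size q < size p)%N
    & p = q + lead_coef p *: 'X^((size p).-1).
Proof.
move=> p_neq0; exists (p - lead_coef p *: 'X^((size p).-1)); last by rewrite subrK.
rewrite (polySpred p_neq0) ltnS; apply/leq_sizeP => j.
rewrite leq_eqVlt coefB coefZ coefXn => /orP[/eqP <-|ltj].
  by rewrite eqxx mulr1 subrr.
rewrite gtn_eqF // mulr0 subr0 nth_default //.
by rewrite (polySpred p_neq0).
Qed.

(** * Adjoining one generator: algebraic and transcendental cases *)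

Section PolySpecialization.
Variables (L : fieldType) (R : comNzRingType) (iota : {rmorphism {poly R} -> L}).
Let iota0 : {rmorphism R -> L} := iota \o polyC.

Let iotaE p : iota p = (map_poly iota0 p).[iota 'X].
Proof.
elim/poly_ind: p => [|p c IHp]; first by rewrite !rmorph0 horner0.
by rewrite !rmorphD !rmorphM /= map_polyX map_polyC /= hornerMXaddC IHp.
Qed.

(** A witness that [iota 'X] is algebraic over the image of [iota0]. Since [iota0] may have a
    kernel, nonvanishing is required of the image of [p], not of [p] itself. *)
Definition algebraic_relation (p : {poly R}) := iota p = 0 /\ map_poly iota0 p <> 0.
Definition minimal_relation (m : {poly R}) :=
  algebraic_relation m /\ forall p, algebraic_relation p -> (size m <= size p)%N.

Lemma minimal_relation_exists p : algebraic_relation p -> exists m, minimal_relation m.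
Proof.
move=> rel_p; pose P n := `[< exists2 q, algebraic_relation q & size q = n >].
have exP : exists n, P n by exists (size p); apply/asboolP; exists p.
case: (ex_minnP exP) => n /asboolP [m rel_m <-] min_m.
exists m; split=> // q rel_q; apply: min_m; apply/asboolP; by exists q.
Qed.

Section Minimal.
Variable m : {poly R}.
Hypothesis min_m : minimal_relation m.

(** Truncating [p] to the size of its image only removes coefficients killed by [iota0]. If the
    image were nonzero, the truncation would be a relation smaller than [m]. *)
Lemma minimal_relation_small p :
  (size (map_poly iota0 p) < size m)%N -> iota p = 0 -> map_poly iota0 p = 0.
Proof.
move=> lt_pm p0; apply: contrapT => p_neq0.
pose q := \poly_(i < size (map_poly iota0 p)) p`_i.
have Dq : map_poly iota0 q = map_poly iota0 p.
  apply/polyP => i; rewrite coef_map coef_poly.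
  case: ltnP => [_|le_pi]; first by rewrite coef_map.
  by rewrite [RHS]nth_default //; apply: (rmorph0 iota0).
have rel_q : algebraic_relation q by split; [rewrite iotaE Dq -iotaE | rewrite Dq].
have := min_m.2 q rel_q; rewrite leqNgt (leq_ltn_trans _ lt_pm) //.
exact: size_poly.
Qed.

(** Otherwise dropping the leading term of [m] would leave its image unchanged and produce a smaller
    relation. *)
Lemma minimal_relation_lead : iota0 (lead_coef m) != 0.
Proof.
have [[m0 mN0] _] := min_m.
have m_neq0 : m != 0 by apply/eqP => m00; apply: mN0; rewrite m00 rmorph0.
have [q ltq Dm] := poly_drop_lead m_neq0.
apply/eqP => lead0; apply: mN0.
have Dm' : map_poly iota0 m = map_poly iota0 q.
  by rewrite {1}Dm rmorphD /= map_polyZ lead0 scale0r addr0.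
rewrite Dm'; apply: minimal_relation_small; last by rewrite iotaE -Dm' -iotaE.
exact: leq_ltn_trans (size_poly _ _) ltq.
Qed.

Lemma minimal_relation_neq0 : m != 0.
Proof.
apply: contraNneq minimal_relation_lead => ->.
by rewrite lead_coef0 rmorph0.
Qed.

Lemma size_minimal_relation : (1 < size m)%N.
Proof.
rewrite ltnNge; apply/negP => /size1_polyC Dm.
have := minimal_relation_lead; have [[m0 _] _] := min_m.
by move: m0; rewrite Dm lead_coefC => /= ->; rewrite eqxx.
Qed.

(* The Euclidean algorithm on [p] and [m], with pseudo-divisions. *)
Lemma minimal_relation_bezout p : iota p != 0 ->
  exists (c : R) (u : {poly R}), iota0 c != 0 /\ iota (u * p) = iota0 c.
Proof.
have [[m0 mN0] _] := min_m.
have [n] := ubnP (size p); elim: n p => // n IHn p; rewrite ltnS => le_pn p_neq0.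
have [le_p1|lt_1p] := leqP (size p) 1.
  exists p`_0, 1; rewrite mul1r /= -size1_polyC //.
have pN0 : p != 0 by rewrite -size_poly_gt0 ltnW.
have [lead0|leadN0] := eqVneq (iota0 (lead_coef p)) 0.
  have [q ltq Dp] := poly_drop_lead pN0.
  have iota_qp : iota q = iota p.
    by rewrite (iotaE q) (iotaE p) [in RHS]Dp rmorphD /= map_polyZ lead0 scale0r addr0.
  have [||c [u [cN0 Du]]] := IHn q; rewrite ?iota_qp ?(leq_trans ltq) //.
  by exists c, u; split=> //; rewrite -Du !rmorphM /= iota_qp.
(* If [m] is not longer than [p], reduce [p] modulo [m]: as [iota m = 0], the remainder maps to
   [iota p] times a power of the image of the leading coefficient of [m], hence not to 0. *)
have [le_mp|lt_pm] := leqP (size m) (size p).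
  have := @Pdiv.ComRing.redivpP _ p m; case: Pdiv.Ring.redivp.
    move=> [k q] r; case=> {}k {}q {}r Dr /(_ minimal_relation_neq0) lt_rm.
  have iota_r : iota r = iota0 (lead_coef m) ^+ k * iota p.
    move/(congr1 iota): Dr; rewrite -mul_polyC rmorphD !rmorphM /= m0 mulr0 add0r.
    by rewrite polyC_exp rmorphXn.
  have [||c [u [cN0 Du]]] := IHn r.
  - by rewrite (leq_trans lt_rm) ?(leq_trans _ le_pn).
  - by rewrite iota_r mulf_neq0 ?expf_neq0 ?minimal_relation_lead.
  exists c, (u * (lead_coef m ^+ k)%:P); split=> //.
  by rewrite -Du !rmorphM /= iota_r polyC_exp rmorphXn mulrA.
(* If [p] is shorter than [m], divide [m] by [p]: the remainder maps to [- iota q * iota p], so the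
   induction applies unless [iota q = 0]. *)
have := @Pdiv.ComRing.redivpP _ m p; case: Pdiv.Ring.redivp.
move=> [k q] r; case=> {}k {}q {}r Dr /(_ pN0) lt_rp.
have iota_r : iota r = - (iota q * iota p).
  move/(congr1 iota): Dr; rewrite -mul_polyC rmorphD !rmorphM /= m0 mulr0.
  by move/esym/eqP; rewrite addrC addr_eq0 => /eqP.
have [q0|qN0] := eqVneq (iota q) 0; last first.
  have [||c [u [cN0 Du]]] := IHn r; rewrite ?(leq_trans lt_rp) //.
    by rewrite iota_r oppr_eq0 mulf_neq0.
  exists c, (- u * q); split=> //.
  by rewrite -Du !rmorphM !rmorphN /= iota_r mulrN !mulNr mulrA.
(* The case [iota q = 0] is impossible. Comparing sizes in this identity over [L], the image of [q]
   is shorter than [m], so it vanishes by minimality; but then [m] would have the size of the image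
   of [r], which is below that of [p]. *)
have Dmr : (iota0 (lead_coef p) ^+ k) *: map_poly iota0 m
    = map_poly iota0 q * map_poly iota0 p + map_poly iota0 r.
  by rewrite -rmorphXn -map_polyZ /= Dr rmorphD rmorphM.
have size_im (s : {poly R}) : (size (map_poly iota0 s) <= size s)%N.
  exact: size_poly.
have size_m : size (map_poly iota0 m) = size m.
  by rewrite size_map_poly_id0 ?minimal_relation_lead.
have size_p : size (map_poly iota0 p) = size p.
  by rewrite size_map_poly_id0.
have lt_rp' : (size (map_poly iota0 r) < size (map_poly iota0 p))%N.
  by rewrite size_p (leq_ltn_trans (size_im r)).
have [qm0|qmN0] := eqVneq (map_poly iota0 q) 0.
  move/(congr1 (fun s : {poly L} => size s)): Dmr.
  rewrite qm0 mul0r add0r size_scale ?expf_neq0 // size_m => Dm.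
  by move: lt_rp'; rewrite -Dm size_p ltnNge (ltnW lt_pm).
have pmN0 : map_poly iota0 p != 0 by rewrite -size_poly_gt0 size_p ltnW.
case/eqP: (qmN0); apply: minimal_relation_small => //.
move/(congr1 (fun s : {poly L} => size s)): Dmr.
have lt_rqp : (size (map_poly iota0 r)
    < size (map_poly iota0 q * map_poly iota0 p)%R)%N.
  by rewrite size_mul // (leq_trans lt_rp') // (polySpred qmN0) addSn leq_addl.
rewrite size_scale ?expf_neq0 // size_m (size_polyDl lt_rqp).
rewrite size_mul // size_p => ->; move: lt_1p.
by case: (size p) => [|[|l]] // _; rewrite !addnS /= ltnS leq_addr.
Qed.
End Minimal.

Hypothesis specR : specializable L R.

(** Choose [phi] on [R] that kills neither the leading coefficient [b] of [m] nor the Bezout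
    constant [c], and send ['X] to a root of the image of [m]. Since [u * a - c] lies in the kernel
    of [iota], [a] survives. *)
Lemma specialize_algebraic m a : minimal_relation m -> iota a != 0 ->
  exists (k : finFieldType) (phi : {rmorphism {poly R} -> k}),
    phi a != 0 /\ forall x, iota x = 0 -> phi x = 0.
Proof.
move=> min_m a_neq0.
have [c [u [cN0 Dc]]] := minimal_relation_bezout min_m a_neq0.
have bN0 := minimal_relation_lead min_m; set b := lead_coef m in bN0.
have bcN0 : iota0 (b * c) != 0 by rewrite rmorphM mulf_neq0.
have [k [phi [phi_bc phi0]]] := specR bcN0.
have [phi_b phi_c] : phi b != 0 /\ phi c != 0.
  by apply/andP; rewrite -negb_or -mulf_eq0 -rmorphM.
have [|k' [j [w rootw]]] := @finField_ext_root k (map_poly phi m).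
  by rewrite size_map_poly_id0 // size_minimal_relation.
pose psi : {rmorphism {poly R} -> k'} := horner_eval w \o map_poly (j \o phi).
have psiE p : psi p = (map_poly j (map_poly phi p)).[w].
  by rewrite /psi /= /horner_eval map_poly_comp.
have psiC x : psi x%:P = j (phi x) by rewrite psiE !map_polyC hornerC.
(* Pseudo-division by [m] writes a power of [b] times [x] as a multiple of [m] plus a remainder. By
   minimality the remainder has all its coefficients in the kernel of [iota0], and [psi b] is
   nonzero. *)
have psi0 x : iota x = 0 -> psi x = 0.
  move=> x0; have := @Pdiv.ComRing.redivpP _ x m; case: Pdiv.Ring.redivp.
  move=> [n q] r; case=> {}n {}q {}r Dr.
  move=> /(_ (minimal_relation_neq0 min_m)) lt_rm.
  have psim : psi m = 0 by rewrite psiE; apply/eqP.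
  have r0 : iota r = 0.
    move/(congr1 iota): Dr; rewrite -mul_polyC rmorphD !rmorphM /= x0.
    by rewrite min_m.1.1 !mulr0 add0r.
  have mr0 : map_poly iota0 r = 0.
    apply: (minimal_relation_small min_m) => //.
    exact: leq_ltn_trans (size_poly _ _) lt_rm.
  have phir : map_poly phi r = 0.
    apply/polyP => i; rewrite coef_map coef0; apply: phi0.
    by rewrite -coef_map mr0 coef0.
  move/(congr1 psi): Dr; rewrite -mul_polyC rmorphD !rmorphM psim mulr0 add0r.
  rewrite [psi r]psiE phir rmorph0 horner0 psiC !rmorphXn /= => /eqP.
  by rewrite mulf_eq0 expf_eq0 fmorph_eq0 (negPf phi_b) andbF => /eqP.
exists k', psi; split=> //.
have /psi0/eqP : iota (u * a - c%:P) = 0 by rewrite rmorphB Dc subrr.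
rewrite rmorphB rmorphM psiC subr_eq0.
by apply: contraTneq => ->; rewrite mulr0 eq_sym fmorph_eq0.
Qed.

(** Without relations, the kernel of [iota] consists of the polynomials whose coefficients are all
    killed by [iota0]. It suffices to preserve one coefficient of [a] and then to evaluate off the
    roots of its image. *)
Lemma specialize_transcendental a : (forall p, ~ algebraic_relation p) -> iota a != 0 ->
  exists (k : finFieldType) (phi : {rmorphism {poly R} -> k}),
    phi a != 0 /\ forall x, iota x = 0 -> phi x = 0.
Proof.
move=> transc a_neq0.
have maN0 : map_poly iota0 a != 0.
  by apply: contraNneq a_neq0 => ma0; rewrite iotaE ma0 horner0.
set i := (size (map_poly iota0 a)).-1.
have cN0 : iota0 a`_i != 0 by rewrite -coef_map -lead_coefE lead_coef_eq0.
have [k [phi [phi_c phi0]]] := specR cN0.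
have phiaN0 : map_poly phi a != 0.
  by apply: contraNneq phi_c => phia0; rewrite -coef_map phia0 coef0.
(* A root [w] of this polynomial makes the value of [a] at [w] invertible. The extension matters:
   every element of [k] itself may be a root of the image of [a]. *)
have [|k' [j [w]]] := @finField_ext_root k (map_poly phi a * 'X - 1).
  have size_pX : (1 < size (map_poly phi a * 'X)%R)%N.
    by rewrite size_mulX // ltnS size_poly_gt0.
  by rewrite size_polyDl // size_polyN size_poly1.
rewrite rmorphB rmorphM rmorph1 /= map_polyX /root !hornerE subr_eq0 => /eqP rootw.
pose psi : {rmorphism {poly R} -> k'} := horner_eval w \o map_poly (j \o phi).
have psiE p : psi p = (map_poly j (map_poly phi p)).[w].
  by rewrite /psi /= /horner_eval map_poly_comp.
exists k', psi; split=> [|x x0]; rewrite psiE.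
  apply/eqP => psi0; move/eqP: rootw.
  by rewrite psi0 mul0r eq_sym oner_eq0.
suff -> : map_poly phi x = 0 by rewrite rmorph0 horner0.
have mx0 : map_poly iota0 x = 0.
  by apply: contrapT => mxN0; apply: (transc x).
apply/polyP => n; rewrite coef_map coef0; apply: phi0.
by rewrite -coef_map mx0 coef0.
Qed.
End PolySpecialization.

Lemma specializable_poly (L : fieldType) (R : comNzRingType) :
  specializable L R -> specializable L {poly R}.
Proof.
move=> specR iota a a_neq0.
have [[p rel_p]|nrel] := pselect (exists p, algebraic_relation iota p).
  have [m min_m] := minimal_relation_exists rel_p.
  exact: specialize_algebraic min_m a_neq0.
apply: specialize_transcendental => // p rel_p; apply: nrel; by exists p.
Qed.

(** The ring is an iterated polynomial ring over [int], with one variable evaluated at each entry of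
    [s]. *)
Lemma specializable_cover (L : numFieldType) (s : seq L) :
  exists (R : comNzRingType) (iota : {rmorphism R -> L}),
    specializable L R /\ forall x, x \in s -> exists y, iota y = x.
Proof.
elim: s => [|z s [R [iota [specR cover]]]].
  by exists int, intr; split=> //; apply: specializable_int.
pose iota' : {rmorphism {poly R} -> L} := horner_eval z \o map_poly iota.
exists {poly R}, iota'; split; first exact: specializable_poly.
move=> x; rewrite inE => /predU1P [->|/cover [y <-]].
  by exists 'X; rewrite /= /horner_eval map_polyX hornerX.
by exists y%:P; rewrite /= /horner_eval map_polyC hornerC.
Qed.

(** * Nonvanishing of exponential sums on a coset *)

Lemma exp_sum_neq0_coset (L : numFieldType) (I J : finType) (a : I -> L)
    (z : I -> J -> L) :
  (forall i k, z i k != 0) -> \sum_i a i != 0 ->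
  exists2 N : nat, (0 < N)%N & forall e : J -> int,
    \sum_i a i * \prod_k z i k ^ (N%:Z * e k) != 0.
Proof.
move=> zN0 sumN0.
(* The inverses are included for the negative exponents; they also force each [Z p] to map to a unit
   of the finite field. *)
pose s := [seq a i | i : I] ++ [seq z p.1 p.2 | p : I * J]
          ++ [seq (z p.1 p.2)^-1 | p : I * J].
have [R [iota [specR cover]]] := specializable_cover s.
have /choice [A DA] : forall i, exists y, iota y = a i.
  by move=> i; apply: cover; rewrite mem_cat map_f ?mem_enum.
have /choice [Z DZ] : forall p : I * J, exists y, iota y = z p.1 p.2.
  move=> p; apply: cover; rewrite !mem_cat.
  by rewrite (map_f (fun p => z p.1 p.2)) ?mem_enum // orbT.
have /choice [W DW] : forall p : I * J, exists y, iota y = (z p.1 p.2)^-1.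
  move=> p; apply: cover; rewrite !mem_cat.
  by rewrite (map_f (fun p => (z p.1 p.2)^-1)) ?mem_enum // !orbT.
have iotaA : iota (\sum_i A i) = \sum_i a i.
  by rewrite rmorph_sum; apply: eq_bigr => i _.
have [|F [phi [phiA phi0]]] := specR iota (\sum_i A i).
  by rewrite iotaA.
have phiZW p : phi (Z p) * phi (W p) = 1.
  apply/eqP; rewrite -rmorphM -subr_eq0 -(rmorph1 phi) -rmorphB phi0 //.
  by rewrite rmorphB rmorphM rmorph1 DZ DW divff ?subrr.
have phiZ p : phi (Z p) ^+ #|F|.-1 = 1.
  apply: expf_card_pred; apply/eqP => Z0; move/eqP: (phiZW p).
  by rewrite Z0 mul0r eq_sym oner_eq0.
have phiW p : phi (W p) ^+ #|F|.-1 = 1.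
  apply: expf_card_pred; apply/eqP => Z0; move/eqP: (phiZW p).
  by rewrite Z0 mulr0 eq_sym oner_eq0.
exists #|F|.-1; first by rewrite -subn1 subn_gt0 finRing_gt1.
move=> e; set N := #|F|.-1 in phiZ phiW *.
(* [U] lifts each power with exponent in [N Z] to an element that [phi] sends to 1, so [phi] cannot
   distinguish the lifted twisted sum from the sum of the [A i]. *)
have /choice [U DU] : forall p : I * J, exists u,
    iota u = z p.1 p.2 ^ (N%:Z * e p.2) /\ phi u = 1.
  move=> p; case: (e p.2) => n.
    exists (Z p ^+ (N * n)); rewrite !rmorphXn /= DZ -PoszM; split=> //.
    by rewrite exprM phiZ expr1n.
  exists (W p ^+ (N * n.+1)); rewrite !rmorphXn /= DW NegzE mulrN -PoszM.
  split; first by rewrite exprVn exprnN.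
  by rewrite exprM phiW expr1n.
apply: contraNneq phiA => sum0.
have /phi0 : iota (\sum_i A i * \prod_k U (i, k)) = 0.
  rewrite rmorph_sum -[RHS]sum0; apply: eq_bigr => i _.
  rewrite rmorphM DA rmorph_prod; congr (_ * _); apply: eq_bigr => k _.
  by have [-> _] := DU (i, k).
move=> phi_sum0; apply/eqP; rewrite -[RHS]phi_sum0 !rmorph_sum; apply: eq_bigr => i _.
rewrite rmorphM rmorph_prod big1 ?mulr1 // => k _.
by have [_ ->] := DU (i, k).
Qed.

Lemma numClosed_prim_root_exists (L : numClosedFieldType) n : (0 < n)%N ->
  exists z : L, n.-primitive_root z.
Proof.
move=> n_gt0; pose p : {poly L} := 'X^n - 1.
have [rs Dp] := closed_field_poly_normal p.
have /monicP lead1 : p \is monic by apply: monicXnsubC.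
rewrite lead1 scale1r in Dp.
have rn1 : all n.-unity_root rs by apply/allP=> z; rewrite -root_prod_XsubC -Dp.
have size_rs : (n < (size rs).+1)%N.
  by rewrite -(size_prod_XsubC rs id) -Dp size_XnsubC.
have [|z _] := hasP (has_prim_root n_gt0 rn1 _ size_rs); last by exists z.
by rewrite -separable_prod_XsubC -Dp separable_Xn_sub_1 // pnatr_eq0 -lt0n.
Qed.

(** * Complex numbers and characters *)

(** Transfers identities in [C] to the algebraically closed field [R[i]], where the general theory
    of fields applies. *)
Definition toC (z : C) : R[i] := Complex z.1 z.2.
Definition ofC (z : R[i]) : C := (complex.Re z, complex.Im z).

Lemma toCK : cancel toC ofC. Proof. by case. Qed.
Lemma ofCK : cancel ofC toC. Proof. by case. Qed.
Lemma toC_inj : injective toC. Proof. exact: can_inj toCK. Qed.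

Lemma toC0 : toC C0 = 0. Proof. by []. Qed.
Lemma toC1 : toC C1 = 1. Proof. by []. Qed.
Lemma toCD z w : toC (Cadd z w) = toC z + toC w. Proof. by []. Qed.
Lemma toCM z w : toC (Cmul z w) = toC z * toC w. Proof. by []. Qed.

Lemma toCV z : toC (Cinv z) = (toC z)^-1.
Proof.
case: z => a b; rewrite /toC /Cinv /Cnorm2 /= !RdivE.
by congr Complex; rewrite -?mulNr !expr2.
Qed.

Lemma toCX z n : toC (Cpow z n) = toC z ^+ n.
Proof. by elim: n => //= n IHn; rewrite toCM IHn exprS. Qed.

Lemma toCXz z n : toC (Czpow z n) = toC z ^ int_of_Z n.
Proof.
case: n => [|p|p] //; rewrite /= toCX //.
rewrite toCV exprVn; congr (_ ^- _); lia.
Qed.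

Lemma toC_sum (I : finType) (f : I -> C) :
  toC (\big[Cadd/C0]_i f i) = \sum_i toC (f i).
Proof. exact: (big_morph toC toCD toC0). Qed.

Lemma toC_prod (I : finType) (f : I -> C) :
  toC (\big[Cmul/C1]_i f i) = \prod_i toC (f i).
Proof. exact: (big_morph toC toCM toC1). Qed.

Lemma unitCE z : unitC z <-> `|toC z| = 1.
Proof.
have -> : unitC z <-> (`|toC z| ^+ 2 = 1).
  rewrite -add_Re2_Im2 /unitC /Cnorm2 /= !expr2.
  rewrite -RplusE -!RmultE.
  by split=> [->|[->]].
by split=> [/eqP|->]; rewrite ?expr1n // sqrp_eq1 // => /eqP.
Qed.

Lemma unitC_neq0 z : unitC z -> toC z != 0.
Proof. by move/unitCE => z1; rewrite -normr_gt0 z1. Qed.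

Lemma toC_ghat_eval (F : finGroupType) (r : nat) (g : GhatRaw F r) p :
  toC (ghat_eval g p)
    = toC (g.1 p.1) * \prod_k toC (p.2 k) ^ int_of_Z (g.2 k).
Proof.
rewrite /ghat_eval toCM toC_prod; congr (_ * _); apply: eq_bigr => k _.
exact: toCXz.
Qed.

Lemma toC_trigpoly (F : finGroupType) (r n : nat) c x (g : GhatRaw F r) :
  toC (@trigpoly F r n c x g) = \sum_i toC (c i) *
    (toC (g.1 (x i).1) * \prod_k toC ((x i).2 k) ^ int_of_Z (g.2 k)).
Proof.
by rewrite toC_sum; apply: eq_bigr => i _; rewrite toCM toC_ghat_eval.
Qed.

Section Characters.
Variables (F : finGroupType) (chi : F -> C).
Hypothesis chi_char : is_char chi.

Lemma char1 : toC (chi 1%g) = 1. Proof. by rewrite chi_char.1. Qed.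

Lemma charM x y : toC (chi (x * y)%g) = toC (chi x) * toC (chi y).
Proof. by rewrite chi_char.2. Qed.

Lemma char_neq0 x : toC (chi x) != 0.
Proof.
apply/eqP => chi0; have := charM x x^-1%g.
by rewrite mulgV char1 chi0 mul0r => /eqP; rewrite oner_eq0.
Qed.

Lemma char_expg x n : toC (chi (x ^+ n)%g) = toC (chi x) ^+ n.
Proof.
by elim: n => [|n IHn]; rewrite ?expg0 ?char1 // expgS charM IHn exprS.
Qed.

Lemma char_exp_card x : toC (chi x) ^+ #|F| = 1.
Proof. by rewrite -char_expg -cardsT expg_cardG ?inE // char1. Qed.
End Characters.

(** Translating the summation variable by a [y] at which the characters differ multiplies the sum by
    the quotient of their values at [y], which is not 1. *)
Lemma char_sum_eq0 (F : finGroupType) (chi psi : F -> C) :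
  is_char chi -> is_char psi -> chi <> psi ->
  \sum_x toC (chi x) / toC (psi x) = 0.
Proof.
move=> chiP psiP neq; have [y neq_y] : exists y, chi y <> psi y.
  apply: contrapT => eq; apply: neq; apply: funext => y.
  by apply: contrapT => neq_y; apply: eq; exists y.
set q := toC (chi y) / toC (psi y); set S := \sum_x _.
have q_neq1 : q != 1.
  apply/eqP => q1; apply: neq_y; apply: toC_inj.
  by apply: (divIf (char_neq0 psiP y)); rewrite -/q q1 divff // char_neq0.
have Dq : S = q * S.
  rewrite {1}/S (reindex_inj (mulgI y)) mulr_sumr; apply: eq_bigr => x _ /=.
  by rewrite !charM // invfM mulrACA.
apply/eqP; move/eqP: Dq; rewrite -subr_eq0 -{1}[S]mul1r -mulrBl mulf_eq0.
by rewrite subr_eq0 eq_sym (negPf q_neq1).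
Qed.

(** A geometric sum whose ratio [z ^ e] differs from 1 but has [n]-th power 1. *)
Lemma prim_root_sum_eq0 (L : fieldType) n (z : L) (e : int) :
  n.-primitive_root z -> ~~ (n %| e)%Z -> \sum_(j < n) (z ^ e) ^+ j = 0.
Proof.
move=> prim_z ndvd.
have : z ^ e != 1.
  apply: contraNN ndvd => /eqP ze; case: e ze => m ze.
    by rewrite dvdzE /= (prim_order_dvd prim_z); apply/eqP.
  rewrite dvdzE /= (prim_order_dvd prim_z) -invr_eq1; apply/eqP.
  by rewrite -[RHS]ze.
rewrite -subr_eq0 => ze1; apply: (mulfI ze1).
by rewrite mulr0 -subrX1 exprnP exprzAC -exprnP prim_expr_order // exp1rz subrr.
Qed.

(** * Subgroups of finite index *)

Definition free_char (F : finGroupType) (r : nat) (m : 'I_r -> Z) : GhatRaw F r :=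
  (fun _ => C1, m).
Arguments free_char F {r} m.

Section FiniteIndex.
Variables (F : finGroupType) (r : nat) (H : GhatRaw F r -> Prop).
Hypothesis subH : ghat_subgroup H.

Lemma subgroup_free_charB u v : H (free_char F u) -> H (free_char F v) ->
  H (free_char F (fun k => u k - v k)%coqZ).
Proof.
move=> Hu Hv; have := subH.2.2 _ _ Hu Hv; congr H; congr pair.
apply: funext => x; apply: toC_inj.
by rewrite /= toCM toCV toC1 invr1 mulr1.
Qed.

Lemma subgroup_free_charMn u (n : nat) : H (free_char F u) ->
  H (free_char F (fun k => Z.of_nat n * u k)%coqZ).
Proof.
move=> Hu; have H0 : H (free_char F (fun _ : 'I_r => 0%coqZ)) := subH.2.1.
elim: n => [|n IHn]; first by [].
(* Closure is available for differences only, so adding [u] is subtracting [0 - u]. *)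
have := subgroup_free_charB IHn (subgroup_free_charB H0 Hu).
by congr (H (free_char F _)); apply: funext => k; lia.
Qed.

(** Pigeonhole: with [n] coset representatives, two of the multiples of [t] by 0, ..., [n] share a
    coset, so [d * t] gives an element of [H] for some positive [d] at most [n]. Such a [d] divides
    the factorial of [n], whatever [t] is. *)
Lemma finite_index_free_char : finite_index H ->
  exists2 N : nat, (0 < N)%N & forall t : 'I_r -> Z,
    H (free_char F (fun k => Z.of_nat N * t k)%coqZ).
Proof.
move=> [n [l [lP cover]]]; exists n`!; first exact: fact_gt0.
move=> t; pose h (j : nat) := free_char F (fun k => Z.of_nat j * t k)%coqZ.
have /choice [f Hf] : forall j : 'I_n.+1, exists i, H (ghat_mul (ghat_inv (l i)) (h j)).
  by move=> j; apply: cover; split=> // x y; apply: toC_inj; rewrite toCM mulr1.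
have : ~~ injectiveb f.
  by apply/negP => /injectiveP /leq_card; rewrite !card_ord ltnn.
case/injectivePn => a [b neq_ab eq_f].
wlog lt_ab : a b neq_ab eq_f / (a < b)%N.
  move=> IH; have : nat_of_ord a != b by [].
  by rewrite neq_ltn => /orP[/IH|lt_ba]; [apply | apply: (IH b a) => //; rewrite eq_sym].
have Hd : H (h (b - a)%N).
  have := Hf a; rewrite eq_f => Ha; have := subH.2.2 _ _ (Hf b) Ha; congr H.
  congr pair; last by apply: funext => k /=; nia.
  apply: funext => x; apply: toC_inj; rewrite /= !(toCM, toCV) toC1 mulr1 divff //.
  by rewrite invr_eq0 char_neq0 //; apply: lP.
have /dvdnP [q ->] : (b - a %| n`!)%N.
  by apply: dvdn_fact; rewrite subn_gt0 lt_ab /=; have := ltn_ord b; lia.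
have := subgroup_free_charMn q Hd.
by congr (H (free_char F _)); apply: funext => k; lia.
Qed.
End FiniteIndex.

(* The trigonometric polynomial below is [#|F| * N ^ r] times the indicator of
   the set of [(chi0, m)] with [m = m0 mod N]. *)
Lemma trigpoly_separating (F : finGroupType) (r N : nat) (g0 : GhatRaw F r) :
  isGhat g0 -> (0 < N)%N ->
  exists (n : nat) (x : 'I_n -> Gpt F r) (c : 'I_n -> C),
    [/\ forall i, inG (x i), trigpoly c x g0 <> C0 &
      forall g, isGhat g -> trigpoly c x g <> C0 ->
        exists t : 'I_r -> Z,
          g = ghat_mul g0 (free_char F (fun k => Z.of_nat N * t k)%coqZ)].
Proof.
move=> g0P N_gt0; have [z prim_z] := numClosed_prim_root_exists R[i] N_gt0.
have zN0 : z != 0.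
  apply/eqP => z0; move/eqP: (prim_expr_order prim_z).
  by rewrite z0 expr0n gtn_eqF // eq_sym oner_eq0.
(* The points run through the finite subgroup of [F] times the [r]-tuples of [N]-th roots of unity,
   and the coefficient at a point is the inverse of the value of [g0] there. *)
pose T : finType := (F * {ffun 'I_r -> 'I_N})%type.
pose x (i : 'I_#|T|) : Gpt F r :=
  ((enum_val i).1, fun k => ofC (z ^+ (enum_val i).2 k)).
pose c (i : 'I_#|T|) : C := ofC ((toC (g0.1 (enum_val i).1))^-1
  * \prod_k (z ^+ (enum_val i).2 k) ^ (- int_of_Z (g0.2 k))).
(* The sum of [g / g0] over this product group factors into a character sum over [F] and one
   geometric sum per coordinate. *)
have trigE g : toC (trigpoly c x g) =
    (\sum_y toC (g.1 y) / toC (g0.1 y)) *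
    \prod_k \sum_(j < N) (z ^ (int_of_Z (g.2 k) - int_of_Z (g0.2 k))) ^+ j.
  rewrite toC_trigpoly (bigA_distr_bigA (fun k (j : 'I_N) =>
    (z ^ (int_of_Z (g.2 k) - int_of_Z (g0.2 k))) ^+ j)) /=.
  rewrite big_distrlr /= pair_big /= [RHS](reindex (@enum_val T predT)) /=; last first.
    exact: onW_bij (enum_val_bij _).
  apply: eq_bigr => i _; rewrite ofCK mulrACA [_^-1 * _]mulrC; congr (_ * _).
  rewrite -big_split /=; apply: eq_bigr => k _.
  rewrite ofCK -expfzDr ?expf_neq0 // addrC !exprnP.
  by rewrite exprzAC.
exists #|T|, x, c; split.
- move=> i k; apply/unitCE; rewrite ofCK normrX.
  have z1 : `|z| = 1.
    by apply/eqP; rewrite -(@pexpr_eq1 _ _ N) // -normrX prim_expr_order // normr1.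
  by rewrite z1 expr1n.
- move/(congr1 toC)/eqP; rewrite trigE toC0 mulf_eq0 => /orP[].
    rewrite (eq_bigr (fun=> 1)); last by move=> y _; rewrite divff // char_neq0.
    rewrite sumr_const pnatr_eq0 gtn_eqF //.
    by apply/card_gt0P; exists 1%g.
  move/prodf_eq0 => [k _]; rewrite subrr expr0z.
  rewrite (eq_bigr (fun=> 1)); last by move=> j _; rewrite expr1n.
  by rewrite sumr_const card_ord pnatr_eq0 gtn_eqF.
move=> g gP gN0; have : toC (trigpoly c x g) != 0.
  by apply/eqP => g0'; apply: gN0; apply: toC_inj.
rewrite trigE mulf_eq0 negb_or => /andP[sumN0 /prodf_neq0 prodN0].
have eq_chi : g.1 = g0.1.
  by apply: contrapT => neq; rewrite char_sum_eq0 ?eqxx in sumN0.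
have /choice [t Dt] : forall k, exists t, g.2 k = (g0.2 k + Z.of_nat N * t)%coqZ.
  move=> k; have /dvdzP [q Dq] : (N %| (int_of_Z (g.2 k) - int_of_Z (g0.2 k)))%Z.
    by apply: contraNT (prodN0 k isT) => ndvd; rewrite (prim_root_sum_eq0 prim_z) ?eqxx.
  exists (Z_of_int q); lia.
exists t; case: g eq_chi Dt {gP gN0 sumN0 prodN0} => chi m /= -> Dt.
congr pair; last by apply: funext => k; rewrite Dt.
by apply: funext => y; apply: toC_inj; rewrite toCM mulr1.
Qed.

(** * The two implications *)

Lemma strictly_pd_ubiquitous (F : finGroupType) (r : nat) (K : GhatRaw F r -> Prop) :
  (forall g, K g -> isGhat g) -> strictly_pd K -> ubiquitous K.
Proof.
move=> KP pdK H subH finH g0 g0P.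
have [N N_gt0 HN] := finite_index_free_char subH finH.
have [n [x [c [xP g0N0 sep]]]] := trigpoly_separating g0P N_gt0.
(* If [K] missed the coset of [g0], the separating polynomial would vanish on [K], hence at [g0] as
   well. *)
apply: contrapT => noh; apply: g0N0; apply: (pdK n x c xP) => // g Kg.
apply: contrapT => /(sep g (KP g Kg)) [t Dg]; apply: noh.
by exists (free_char F (fun k => Z.of_nat N * t k)%coqZ); rewrite -Dg.
Qed.

Lemma free_char_subgroup (F : finGroupType) (r N : nat) :
  ghat_subgroup (fun g : GhatRaw F r =>
    exists t : 'I_r -> Z, g = free_char F (fun k => Z.of_nat N * t k)%coqZ).
Proof.
split; last split.
- by move=> _ [t ->]; split=> // x y; apply: toC_inj; rewrite toCM mulr1.
- by exists (fun=> 0%coqZ); congr pair; apply: funext => k; lia.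
move=> _ _ [t ->] [u ->]; exists (fun k => t k - u k)%coqZ; congr pair.
  by apply: funext => x; apply: toC_inj; rewrite /= toCM toCV toC1 divff ?oner_eq0.
by apply: funext => k /=; lia.
Qed.

(** A character of [F] takes values in the [#|F|]-th roots of unity, so there are finitely many of
    them; the exponents are represented by their residues modulo [N]. *)
Lemma free_char_finite_index (F : finGroupType) (r N : nat) : (0 < N)%N ->
  finite_index (fun g : GhatRaw F r =>
    exists t : 'I_r -> Z, g = free_char F (fun k => Z.of_nat N * t k)%coqZ).
Proof.
move=> N_gt0; have F_gt0 : (0 < #|F|)%N by apply/card_gt0P; exists 1%g.
have [z prim_z] := numClosed_prim_root_exists R[i] F_gt0.
pose T : finType := ({ffun F -> 'I_#|F|} * {ffun 'I_r -> 'I_N})%type.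
pose rep (p : T) : GhatRaw F r :=
  (fun y => ofC (z ^+ p.1 y), fun k => Z.of_nat (p.2 k)).
(* The enumeration runs over all functions from [F] to the roots of unity; those that are not
   characters are replaced by the trivial character as a default. *)
exists #|T|, (fun i => if `[< isGhat (rep (enum_val i)) >] then rep (enum_val i)
                       else ghat_one F r).
split=> [i|g gP].
  case: asboolP => // _.
  by split=> // x y; apply: toC_inj; rewrite toCM mulr1.
have /choice [f Df] : forall y, exists j : 'I_#|F|, toC (g.1 y) = z ^+ j.
  by move=> y; have [j ->] := prim_rootP prim_z (char_exp_card gP y); exists j.
have /choice [v Dv] : forall k, exists j : 'I_N,
    exists t, g.2 k = (Z.of_nat j + Z.of_nat N * t)%coqZ.
  move=> k; have lt_N : (Z.to_nat (g.2 k mod Z.of_nat N) < N)%N.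
    have := Z.mod_pos_bound (g.2 k) (Z.of_nat N); lia.
  exists (Ordinal lt_N), (g.2 k / Z.of_nat N)%coqZ => /=.
  have := Z.mod_pos_bound (g.2 k) (Z.of_nat N).
  have := Z.div_mod (g.2 k) (Z.of_nat N); lia.
have /choice [t Dt] := Dv.
exists (enum_rank ([ffun y => f y], [ffun k => v k])); rewrite enum_rankK.
have Dchi : (rep ([ffun y => f y], [ffun k => v k])).1 = g.1.
  by apply: funext => y; apply: toC_inj; rewrite /= ofCK ffunE Df.
case: asboolP => [_|[]]; last by rewrite /isGhat Dchi.
exists t; congr pair; last by apply: funext => k /=; rewrite Dt ffunE; lia.
apply: funext => y; apply: toC_inj.
by rewrite /= toCM toCV ofCK ffunE Df mulVf // -Df char_neq0.
Qed.

Lemma ubiquitous_strictly_pd (F : finGroupType) (r : nat) (K : GhatRaw F r -> Prop) :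
  ubiquitous K -> strictly_pd K.
Proof.
move=> ubK n x c xP K0 g0 g0P; apply: contrapT => g0N0.
pose z i k := toC ((x i).2 k).
(* Absorbing the values of [g0] into the coefficients makes the sum of the [a i] the value at [g0],
   and moving within the coset twists its terms by [N]-th powers. *)
pose a i := toC (c i) *
  (toC (g0.1 (x i).1) * \prod_k z i k ^ int_of_Z (g0.2 k)).
have zN0 i k : z i k != 0 by apply: unitC_neq0; apply: xP.
have sumN0 : \sum_i a i != 0.
  by rewrite -toC_trigpoly; apply/eqP => g00; apply: g0N0; apply: toC_inj.
have [N N_gt0 sumN] := exp_sum_neq0_coset zN0 sumN0.
have [_ [[t ->]]] := ubK _ (free_char_subgroup F r N)
  (free_char_finite_index F r N_gt0) g0 g0P.
move/K0/(congr1 toC); rewrite toC_trigpoly toC0; apply/eqP.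
apply: contraNneq (sumN (fun k => int_of_Z (t k))) => sum0.
rewrite -[X in _ == X]sum0; apply/eqP; apply: eq_bigr => i _ /=.
rewrite /a toCM toC1 mulr1 -!mulrA -big_split /=; do 2 congr (_ * _).
apply: eq_bigr => k _; rewrite -expfzDr //; congr (_ ^ _); lia.
Qed.

Theorem theorem1p1 (F : finGroupType) (r : nat) (K : GhatRaw F r -> Prop) :
  abelian [set: F] ->
  (forall g, K g -> isGhat g) ->
  (strictly_pd K <-> ubiquitous K).
Proof.
by move=> _ KP; split; [apply: strictly_pd_ubiquitous | apply: ubiquitous_strictly_pd].
Qed.
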